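(* Every central reduced ring is $2$-primal. The converse holds for semiprime rings; that is, every semiprime $2$-primal ring is central reduced.
   Context: All rings are associative with identity, not necessarily commutative. A ring $R$ is called central reduced if every nilpotent element of $R$ is central. Let $P(R)$ denote the prime radical of $R$ (the intersection of all prime ideals of $R$) and $N(R)$ the set of all nilpotent elements of $R$. The ring $R$ is called $2$-primal if $P(R)=N(R)$. A ring $R$ is semiprime if for $a\in R$, $aRa=0$ implies $a=0$. *)

(* Defs.v *)
From HB Require Import structures.
From mathcomp Require Import all_boot all_order all_algebra.
From mathcomp Require Import boolp classical_sets.

Set Implicit Arguments.
Unset Strict Implicit.
Unset Printing Implicit Defensive.

Import GRing.Theory.
Local Open Scope classical_set_scope.
Local Open Scope ring_scope.

(* Ideals are arbitrary subsets [set R], not decidable predicates: the [idealr]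
   and [prime_idealr] of ring_quotient.v are boolean, one-sided, and meant for
   commutative rings (completely prime rather than prime), so they cannot
   express the prime radical of a noncommutative ring.  The zero ring is
   allowed, hence [pzRingType]. *)

Definition two_sided_ideal (R : pzRingType) (I : set R) : Prop :=
  [/\ I 0,
      forall x y, I x -> I y -> I (x - y),
      forall r x, I x -> I (r * x)
    & forall x r, I x -> I (x * r)].

(* The product of two ideals: finite sums of products, not just products. *)
Definition ideal_mul (R : pzRingType) (I J : set R) : set R :=
  [set x | exists (n : nat) (a b : 'I_n -> R),
    [/\ forall i, I (a i), forall i, J (b i) & x = \sum_(i < n) a i * b i]].

Definition prime_ideal (R : pzRingType) (P : set R) : Prop :=
  [/\ two_sided_ideal P,
      P <> setT
    & forall I J : set R, two_sided_ideal I -> two_sided_ideal J ->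
        ideal_mul I J `<=` P -> I `<=` P \/ J `<=` P].

(* The zero ring has no prime ideal; the empty intersection is then [setT]. *)
Definition prime_radical (R : pzRingType) : set R :=
  \bigcap_(P in [set P : set R | prime_ideal P]) P.
Arguments prime_radical R : clear implicits.

Definition nilpotent_elements (R : pzRingType) : set R :=
  [set x | exists n : nat, x ^+ n = 0].
Arguments nilpotent_elements R : clear implicits.

Definition central (R : pzRingType) (x : R) : Prop :=
  forall y : R, GRing.comm x y.

Definition central_reduced (R : pzRingType) : Prop :=
  forall x : R, nilpotent_elements R x -> central x.

Definition two_primal (R : pzRingType) : Prop :=
  prime_radical R = nilpotent_elements R.

Definition semiprime (R : pzRingType) : Prop :=
  forall a : R, (forall r : R, a * r * a = 0) -> a = 0.

(* Main.v *)
Require Import Defs.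
From mathcomp Require Import all_boot all_order all_algebra.
From mathcomp Require Import boolp classical_sets.

(** In any ring, an m-system avoiding [0] is avoided by some prime ideal: an
    ideal maximal among those disjoint from it is prime.  The powers of a
    non-nilpotent element form an m-system, so the prime radical is always nil.
    Conversely, if [x] is central and [x * y] lies in a prime ideal then so does
    [x] or [y], so central nilpotent elements lie in every prime ideal.  In a
    semiprime ring each [a <> 0] starts an m-system [a_0 = a],
    [a_(i+1) = a_i * r_i * a_i <> 0], so the prime radical is zero; being
    2-primal then means being reduced. *)

Import GRing.Theory.
Local Open Scope classical_set_scope.
Local Open Scope ring_scope.

Definition ideal_add {R : pzRingType} (I J : set R) : set R :=
  [set z | exists x y, [/\ I x, J y & z = x + y]].

(** The noncommutative counterpart of a multiplicative set; complements of prime ideals have this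
    property. *)
Definition m_system {R : pzRingType} (S : set R) : Prop :=
  forall s t, S s -> S t -> exists r, S (s * r * t).

Section Ideals.
Context {R : pzRingType}.
Implicit Types (I J Q S : set R) (x y r : R).

Lemma two_sided_idealD {I} x y :
  two_sided_ideal I -> I x -> I y -> I (x + y).
Proof.
case=> I0 IB _ _ Ix Iy; rewrite -[y]opprK; apply: (IB _ _ Ix).
by rewrite -[- y]add0r; apply: IB.
Qed.

Lemma ideal_add_ideal I J :
  two_sided_ideal I -> two_sided_ideal J -> two_sided_ideal (ideal_add I J).
Proof.
move=> [I0 IB Il Ir] [J0 JB Jl Jr]; split.
- by exists 0, 0; split; rewrite ?addr0.
- move=> _ _ [x [y [Ix Jy ->]]] [x' [y' [Ix' Jy' ->]]].
  exists (x - x'), (y - y'); split; [exact: IB | exact: JB |].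
  by rewrite opprD addrACA.
- move=> r _ [x [y [Ix Jy ->]]]; exists (r * x), (r * y).
  by split; [exact: Il | exact: Jl | rewrite mulrDr].
- move=> _ r [x [y [Ix Jy ->]]]; exists (x * r), (y * r).
  by split; [exact: Ir | exact: Jr | rewrite mulrDl].
Qed.

Lemma sub_ideal_addl {I J} : two_sided_ideal J -> I `<=` ideal_add I J.
Proof. by case=> J0 _ _ _ x Ix; exists x, 0; rewrite addr0. Qed.

Lemma sub_ideal_addr {I J} : two_sided_ideal I -> J `<=` ideal_add I J.
Proof. by case=> I0 _ _ _ y Jy; exists 0, y; rewrite add0r. Qed.

Lemma mem_ideal_mul {I J} x y : I x -> J y -> ideal_mul I J (x * y).
Proof.
move=> Ix Jy; exists 1%N, (fun=> x), (fun=> y).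
by split=> //; rewrite big_ord1.
Qed.

Lemma sub_ideal_mul {I J Q} : two_sided_ideal Q ->
  (forall x y, I x -> J y -> Q (x * y)) -> ideal_mul I J `<=` Q.
Proof.
move=> idQ IJQ _ [n [a [b [Ia Jb ->]]]].
apply: (big_ind Q) => [|x y|i _]; first by case: idQ.
- exact: two_sided_idealD.
- exact: IJQ.
Qed.

Lemma exists_maximal_ideal_avoiding {S} : ~ S 0 ->
  exists Q, [/\ two_sided_ideal Q, Q `<=` ~` S
    & forall I, two_sided_ideal I -> Q `<` I -> exists2 s, S s & I s].
Proof.
move=> S0.
(* [A 0] is left out so that the union of the empty chain qualifies. *)
pose good (A : set R) := [/\ forall x y, A x -> A y -> A (x - y),
  forall r x, A x -> A (r * x), forall x r, A x -> A (x * r) & A `<=` ~` S].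
have [F goodF totF|Q [goodQ maxQ]] := @Zorn_bigcup _ good.
  split.
  - move=> x y [A FA Ax] [B FB By]; case: (totF _ _ FA FB) => sub.
      by exists B => //; case: (goodF _ FB) => + _ _ _; apply=> //; apply: sub.
    by exists A => //; case: (goodF _ FA) => + _ _ _; apply=> //; apply: sub.
  - by move=> r x [A FA Ax]; exists A => //; case: (goodF _ FA) => _ + _ _; apply.
  - by move=> x r [A FA Ax]; exists A => //; case: (goodF _ FA) => _ _ + _; apply.
  - by move=> x [A FA Ax]; case: (goodF _ FA) => _ _ _; apply.
have [QB Ql Qr QS] := goodQ.
(* Since [0 * x] is in [Q] for every [x] in [Q], a [Q] without [0] is empty. It would then lie
   strictly inside [[set 0]], which is [good] because [0] is not in [S]. *)
have Q0 : Q 0.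
  apply: contrapT => nQ0; apply: (maxQ [set 0]).
    split=> [x Qx|sub]; last exact/nQ0/sub.
    by case: nQ0; rewrite -(mul0r x); apply: Ql.
  split=> [x y -> ->|r x ->|x r ->|x ->] //=.
  - by rewrite subr0.
  - by rewrite mulr0.
  - by rewrite mul0r.
exists Q; split=> // I [I0 IB Il Ir] QI; apply: contrapT => nS.
apply: (maxQ I) => //; split=> // x Ix Sx.
by apply: nS; exists x.
Qed.

(** If neither [I] nor [J] lies in the maximal [Q], then [S] contains some [s = q + i] and
    [t = q' + j], hence some [s * r * t]. Modulo [Q] this is [i * r * j], so [ideal_mul I J] inside
    [Q] would force [Q] to meet [S]. *)
Lemma exists_prime_ideal_avoiding S : m_system S -> S !=set0 -> ~ S 0 ->
  exists2 Q, prime_ideal Q & Q `<=` ~` S.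
Proof.
move=> mS [s0 Ss0] S0.
have [Q [idQ QS maxQ]] := exists_maximal_ideal_avoiding S0.
exists Q => //; split=> // [QT|I J idI idJ IJQ].
  by apply: (QS s0) => //; rewrite QT.
have meets K : two_sided_ideal K -> ~ (K `<=` Q) ->
    exists2 s, S s & ideal_add Q K s.
  move=> idK nKQ; apply: maxQ; first exact: ideal_add_ideal.
  split; first exact: sub_ideal_addl.
  by move=> sub; apply: nKQ => x Kx; apply/sub/sub_ideal_addr.
apply: contrapT => /not_orP[nIQ nJQ].
have [s Ss [q [i [Qq Ii Es]]]] := meets I idI nIQ.
have [t St [q' [j [Qq' Jj Et]]]] := meets J idJ nJQ.
have [r Sr] := mS _ _ Ss St; apply: QS Sr.
have [_ _ Ql Qr] := idQ; have [_ _ _ Ir] := idI.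
rewrite Es Et mulrDr; apply: (two_sided_idealD _ _ idQ); first exact: Ql.
rewrite !mulrDl; apply: (two_sided_idealD _ _ idQ); first exact/Qr/Qr.
by apply: IJQ; apply: mem_ideal_mul => //; apply: Ir.
Qed.

(** Centrality of [x] makes both [x R] and the set of [z] with [x * z] in [Q] two-sided ideals, and
    their product lies in [Q] because [x * r * z = r * (x * z)]. *)
Lemma prime_ideal_central {Q x y} :
  prime_ideal Q -> central x -> Q (x * y) -> Q x \/ Q y.
Proof.
move=> [idQ _ primeQ] cx Qxy; have [Q0 QB Ql Qr] := idQ.
pose I : set R := [set z | exists r, z = x * r].
pose J : set R := [set z | Q (x * z)].
have idI : two_sided_ideal I.
  split=> [|_ _ [r ->] [r' ->]|r _ [r' ->]|_ r [r' ->]].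
  - by exists 0; rewrite mulr0.
  - by exists (r - r'); rewrite mulrBr.
  - by exists (r * r'); rewrite !mulrA cx.
  - by exists (r' * r); rewrite mulrA.
have idJ : two_sided_ideal J.
  split=> [|z z' Jz Jz'|r z Jz|z r Jz]; rewrite /J /=.
  - by rewrite mulr0.
  - by rewrite mulrBr; apply: QB.
  - by rewrite mulrA cx -mulrA; apply: Ql.
  - by rewrite mulrA; apply: Qr.
case: (primeQ I J idI idJ) => [|sub|sub].
- by apply: sub_ideal_mul => // _ z [r ->] Jz; rewrite cx -mulrA; apply: Ql.
- by left; apply: sub; exists 1; rewrite mulr1.
- by right; apply: sub.
Qed.

End Ideals.

Section Radical.
Context {R : pzRingType}.

Lemma prime_radical_nil : prime_radical R `<=` nilpotent_elements R.
Proof.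
move=> x Px; apply: contrapT => nilx.
have [||[n xn0]|Q primeQ QS] :=
    @exists_prime_ideal_avoiding R [set y | exists n : nat, y = x ^+ n].
- move=> _ _ [m ->] [n ->]; exists 1, (m + n)%N.
  by rewrite mulr1 exprD.
- by exists 1, 0%N; rewrite expr0.
- by apply: nilx; exists n.
- by apply: (QS x); [exact: Px | exists 1%N; rewrite expr1].
Qed.

Lemma central_nilpotent_prime_radical (x : R) :
  central x -> nilpotent_elements R x -> prime_radical R x.
Proof.
move=> cx [n xn0] Q primeQ; have [[Q0 _ Ql _] _ _] := primeQ.
have : Q (x ^+ n) by rewrite xn0.
(* At exponent [0] the hypothesis says that [1] is in [Q], so [x = x * 1] is too. *)
elim: n {xn0} => [|n IHn]; first by move=> /(Ql x); rewrite mulr1.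
by rewrite exprS => /(prime_ideal_central primeQ cx) [].
Qed.

Lemma semiprime_prime_radical (a : R) :
  semiprime R -> prime_radical R a -> a = 0.
Proof.
move=> spR Pa; apply: contrapT => a0.
(* The guard [b <> 0] sits under the existential so that [f] is total; its value at [0] is
   arbitrary. *)
have /choice[f f_neq0] : forall b : R, exists r, b <> 0 -> b * r * b <> 0.
  move=> b; apply: contrapT => /forallNP nr; apply: (nr 0) => b0 _.
  apply: b0; apply: spR => r; apply: contrapT => brb.
  exact: (nr r).
pose u n := iter n (fun b => b * f b * b) a.
have u_neq0 n : u n <> 0 by elim: n => //= n; apply: f_neq0.
have u_left n k : exists s, u (n + k)%N = u n * s.
  elim: k => [|k [s us]]; first by exists 1; rewrite addn0 mulr1.
  by exists (s * f (u (n + k)%N) * u (n + k)%N); rewrite addnS /= !mulrA -us.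
have u_right n k : exists s, u (n + k)%N = s * u n.
  elim: k => [|k [s us]]; first by exists 1; rewrite addn0 mul1r.
  by exists (u (n + k)%N * f (u (n + k)%N) * s); rewrite addnS /= -!mulrA -us.
have [||[n /esym/u_neq0]|Q primeQ QS] //:=
    @exists_prime_ideal_avoiding R [set b | exists n : nat, b = u n].
- move=> _ _ [m ->] [n ->].
  have [s us] := u_left m n; have [t ut] := u_right n m.
  (* The term [u (m + n)] is both [u m * s] and [t * u n], so the next term of the sequence starts
     with [u m] and ends with [u n]. *)
  exists (s * f (u (m + n)%N) * t), (m + n).+1.
  by rewrite !mulrA -us -(mulrA _ t) -ut [(n + m)%N]addnC.
- by exists a, 0%N.
- by apply: (QS a); [exact: Pa | exists 0%N].
Qed.

End Radical.

Theorem theorem2p15 (R : pzRingType) :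
  (central_reduced R -> two_primal R) /\
  (semiprime R -> two_primal R -> central_reduced R).
Proof.
split=> [crR|spR tpR x].
  apply/seteqP; split=> [|x nilx]; first exact: prime_radical_nil.
  by apply: central_nilpotent_prime_radical => //; apply: crR.
rewrite -tpR => /(semiprime_prime_radical _ spR) -> y.
exact/commr_sym/commr0.
Qed.
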